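(* Let $p_k$ denote the $k$-th prime ($p_1=2,p_2=3,\ldots$) and define $s_n=\sum_{k=1}^n(-1)^{n-k}p_k$ for all $n\in\mathbb{Z}^+$. Then for any $n\in\mathbb{Z}^+$, the numbers $2s_k^2$ $(k=1,\ldots,n)$ are pairwise distinct modulo $p_{n+1}$.
   Context: $\mathbb{Z}^+=\{1,2,3,\ldots\}$. *)

(* Defs.v *)
From mathcomp Require Import all_boot all_order all_algebra.

Set Implicit Arguments.
Unset Strict Implicit.
Unset Printing Implicit Defensive.

Import GRing.Theory.

Lemma ex_prime_gt (m : nat) : exists p, (m < p) && prime p.
Proof. by have [p lt_mp p_pr] := prime_above m; exists p; rewrite lt_mp. Qed.

Definition next_prime (m : nat) : nat := ex_minn (ex_prime_gt m).

(* 1-based: kth_prime 1 = 2, kth_prime 2 = 3; kth_prime 0 = 0 is a dummy value *)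
Definition kth_prime (k : nat) : nat := iter k next_prime 0.

Lemma next_primeP (m : nat) :
  [/\ m < next_prime m, prime (next_prime m)
    & forall q, m < q -> prime q -> next_prime m <= q].
Proof.
rewrite /next_prime; case: ex_minnP => p /andP[lt_mp p_pr] min_p.
by split=> // q lt_mq q_pr; apply: min_p; rewrite lt_mq.
Qed.

Lemma prime_kth_prime (k : nat) : 0 < k -> prime (kth_prime k).
Proof. by case: k => // k _; have [] := next_primeP (kth_prime k). Qed.

Lemma kth_prime_ltS (k : nat) : kth_prime k < kth_prime k.+1.
Proof. by have [] := next_primeP (kth_prime k). Qed.

Lemma kth_prime_surj (q : nat) :
  prime q -> exists2 k, 0 < k & kth_prime k = q.
Proof.
move=> q_pr.
have le_k k : k <= kth_prime k.
  by elim: k => // k IHk; apply: leq_ltn_trans IHk (kth_prime_ltS k).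
have exk : exists k, q <= kth_prime k by exists q.
case: (ex_minnP exk) => -[|k] le_qk min_k.
  by move: (leq_trans (prime_gt0 q_pr) le_qk).
exists k.+1 => //; apply/eqP; rewrite eqn_leq le_qk andbT.
have [_ _ -> //] := next_primeP (kth_prime k).
by rewrite ltnNge; apply/negP => /min_k; rewrite ltnn.
Qed.

Local Open Scope ring_scope.

Definition alt_prime_sum (n : nat) : int :=
  \sum_(1 <= k < n.+1) (-1) ^+ (n - k) * (kth_prime k)%:Z.

(* Main.v *)
(** Writing s_k for the alternating sum, s_k = p_k - s_{k-1}, so that
    0 < s_k <= p_k, and s_k has the parity of k + 1.  For j < k the number
    s_k - (-1)^(k-j) s_j is the alternating sum of p_{j+1}, ..., p_k; it
    satisfies the same recurrence, hence lies in (0, p_k] and is not divisible by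
    p = p_{n+1}.  The other number s_k + (-1)^(k-j) s_j is handled by parity:
    if k - j is even it is even and lies in (0, 2p), if k - j is odd it is odd
    and lies in (-p, p). *)

Require Import Defs.
From mathcomp Require Import all_boot all_order all_algebra.
From mathcomp Require Import zify ring.

Set Implicit Arguments.
Unset Strict Implicit.

Import Order.POrderTheory GRing.Theory Num.Theory.

Local Open Scope ring_scope.

Lemma kth_prime_lt (j k : nat) : (j < k)%N -> (kth_prime j < kth_prime k)%N.
Proof. exact: (homo_ltn ltn_trans kth_prime_ltS). Qed.

Lemma odd_kth_prime (k : nat) : (1 < k)%N -> odd (kth_prime k).
Proof.
move=> k_gt1; have k_gt0 := ltnW k_gt1.
have [p2 | //] := even_prime (prime_kth_prime k_gt0).
have := prime_gt1 (prime_kth_prime (isT : (0 < 1)%N)).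
by have := kth_prime_lt k_gt1; rewrite p2 ltnNge => /negPf ->.
Qed.

Lemma alt_prime_sum0 : alt_prime_sum 0 = 0.
Proof. by rewrite /alt_prime_sum big_geq. Qed.

Lemma alt_prime_sumS (k : nat) :
  alt_prime_sum k.+1 = (kth_prime k.+1)%:Z - alt_prime_sum k.
Proof.
rewrite /alt_prime_sum big_nat_recr //= subnn expr0 mul1r addrC; congr (_ + _).
rewrite big_nat_cond -sumrN [RHS]big_nat_cond; apply: eq_bigr => i.
by rewrite andbT => /andP[_ le_ik]; rewrite subSn // exprS mulN1r mulNr.
Qed.

(** Since t(k) <= p_k < p_{k+1}, the recurrence puts t(k+1) in (0, p_{k+1}]. The lower bound at [j]
    is not strict, so [t] may start at 0, as both the full sum (with the dummy value [kth_prime 0] =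
    0) and its tails do. *)
Lemma alt_rec_bounds (t : nat -> int) (j : nat) :
    0 <= t j <= (kth_prime j)%:Z ->
    (forall k, (j <= k)%N -> t k.+1 = (kth_prime k.+1)%:Z - t k) ->
  forall k, (j < k)%N -> 0 < t k <= (kth_prime k)%:Z.
Proof.
move=> tj tS; elim=> // k IHk; rewrite ltnS => le_jk.
have tk : 0 <= t k <= (kth_prime k)%:Z.
  move: le_jk; rewrite leq_eqVlt => /predU1P[<- // | /IHk /andP[t_gt0 ->]].
  by rewrite ltW.
by rewrite tS //; move: tk (kth_prime_ltS k); lia.
Qed.

Lemma alt_prime_sum_bounds (k : nat) :
  (0 < k)%N -> 0 < alt_prime_sum k <= (kth_prime k)%:Z.
Proof.
apply: alt_rec_bounds => [|i _]; last exact: alt_prime_sumS.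
by rewrite alt_prime_sum0.
Qed.

Lemma alt_prime_sum_tail_bounds (j k : nat) : (j < k)%N ->
  0 < alt_prime_sum k - (-1) ^+ (k - j) * alt_prime_sum j <= (kth_prime k)%:Z.
Proof.
pose t i := alt_prime_sum i - (-1) ^+ (i - j) * alt_prime_sum j.
apply: (@alt_rec_bounds t) => [|i le_ji]; rewrite /t.
  by rewrite subnn mul1r subrr lexx.
by rewrite alt_prime_sumS subSn // exprS; ring.
Qed.

(** The first sum is 2 and all later primes are odd, so each further step of the recurrence flips
    the parity. *)
Lemma alt_prime_sum_parity (k : nat) :
  (0 < k)%N -> exists c : int, alt_prime_sum k = 2 * c + (~~ odd k)%:Z.
Proof.
elim: k => // -[|k] IHk _.
  exists 1; rewrite alt_prime_sumS alt_prime_sum0 subr0; congr Posz.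
  have [_ p1_pr p1_min] := next_primeP 0; apply/eqP.
  by rewrite eqn_leq p1_min // prime_gt1.
have [c sE] := IHk isT.
have pE := odd_double_half (kth_prime k.+2).
rewrite odd_kth_prime // in pE.
exists ((kth_prime k.+2)./2%:Z - c).
by rewrite alt_prime_sumS sE !oddS negbK; case: (odd k); lia.
Qed.

Theorem theorem1p5 (n : nat) (hn : (0 < n)%N) (j k : nat)
    (hj : (1 <= j <= n)%N) (hk : (1 <= k <= n)%N) (hjk : j <> k) :
  (2 * alt_prime_sum j ^+ 2 <> 2 * alt_prime_sum k ^+ 2
     %[mod (kth_prime n.+1)%:Z])%Z.
Proof.
wlog lt_jk : j k hj hk hjk / (j < k)%N.
  move=> wlog_lt; have [/wlog_lt | /wlog_lt + /esym | //] := ltngtP j k.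
    exact.
  by apply=> // /esym.
have [/andP[j_gt0 _] /andP[k_gt0 le_kn]] := (hj, hk).
have p_pr := prime_kth_prime (ltn0Sn n).
have p_odd : odd (kth_prime n.+1) by apply: odd_kth_prime; rewrite ltnS.
have p_gtk : (kth_prime k < kth_prime n.+1)%N by apply: kth_prime_lt.
have p_gtj := kth_prime_lt lt_jk.
have sj := alt_prime_sum_bounds j_gt0; have sk := alt_prime_sum_bounds k_gt0.
have tail := alt_prime_sum_tail_bounds lt_jk.
have [a sjE] := alt_prime_sum_parity j_gt0.
have [b skE] := alt_prime_sum_parity k_gt0.
(* The sign in [tail] now depends only on the parities of [j] and [k]. *)
rewrite -signr_odd oddB 1?ltnW // in tail.
move: p_pr p_odd p_gtk p_gtj sj sk tail sjE skE.
set p := kth_prime n.+1; set x := alt_prime_sum j; set y := alt_prime_sum k.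
move=> p_pr p_odd p_gtk p_gtj sj sk tail sjE skE /esym/eqP.
rewrite eqz_mod_dvd -mulrBr subr_sqr !dvdzE !abszM /= !Euclid_dvdM //.
have pE := odd_double_half p; rewrite p_odd in pE.
case/or3P=> /dvdnP[q qE].
- by have := prime_gt1 p_pr; nia.
(* Both sums lie in (0, p), so |y - x| < p and y = x. Parity refutes this if k - j is odd, [tail] if
   it is even. *)
- have q0 : q = 0%N by case: q qE => [|q] // qE; exfalso; nia.
  by move: tail; case: (odd k) (odd j) sjE skE => -[] /=; lia.
(* As 0 < x + y < 2p, only x + y = p remains. Parity refutes it if k - j is even; otherwise [tail]
   gives x + y <= p_k < p. *)
- have qlt2 : (q < 2)%N by nia.
  by case: (odd k) (odd j) sjE skE tail => -[] /=; case: q qE qlt2 => [|[|q]] //; lia.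
Qed.
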